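(* For integers $N\ge1$, $k\ge0$ and $m_1,\dots,m_N\ge0$, $$\big|\{(l,l^o)\in D_N:\ |l|=k,\ l^o_{\{1\}}=\dots=l^o_{\{N\}}=0\}\big|=\sum_{(\hat m_1,\dots,\hat m_N)+(\check m_1,\dots,\check m_N)=(m_1,\dots,m_N)}\hat{\mathtt C}(\hat m_1,\dots,\hat m_N)\,\check{\mathtt C}(k;\check m_1,\dots,\check m_N),$$ where the sum is over all pairs of tuples of nonnegative integers with the indicated sum.
   Context: Let $\eta_N=2^N-1$ and let $\mathbf e_1,\dots,\mathbf e_{\eta_N}$ enumerate the nonempty subsets of $\{1,\dots,N\}$ such that $\mathbf e_1,\dots,\mathbf e_N$ are the singletons. For integers $m_1,\dots,m_N\ge0$, $D_N$ is the set of pairs $(l,l^o)$ of families of nonnegative integers $l=(l_{\mathbf e_n})_{1\le n\le\eta_N}$, $l^o=(l^o_{\mathbf e_n})_{1\le n\le\eta_N}$ with $\sum_{n=1}^{\eta_N}(l_{\mathbf e_n}+l^o_{\mathbf e_n})\mathbf 1_{\mathbf e_n}(j)=m_j$ for all $j=1,\dots,N$; $|l|=\sum_n l_{\mathbf e_n}$. Further, $$\hat{\mathtt C}(m_1,\dots,m_N):=\Big|\Big\{(l^o_{\mathbf e_{N+1}},\dots,l^o_{\mathbf e_{\eta_N}})\in\{0,1,\dots\}^{\eta_N-N}:\ \sum_{n\ge N+1,\ i\in\mathbf e_n}l^o_{\mathbf e_n}=m_i\ \ \forall i\in\{1,\dots,N\}\Big\}\Big|,$$ $$\check{\mathtt C}(k;m_1,\dots,m_N):=\Big|\Big\{(l_{\mathbf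 e_1},\dots,l_{\mathbf e_{\eta_N}})\in\{0,1,\dots\}^{\eta_N}:\ \sum_{n=1}^{\eta_N}l_{\mathbf e_n}=k,\ \sum_{n:\,i\in\mathbf e_n}l_{\mathbf e_n}=m_i\ \ \forall i\in\{1,\dots,N\}\Big\}\Big|.$$ *)

(* Defs.v *)
From mathcomp Require Import all_boot finmap.
From mathcomp Require Import all_classical.

Set Implicit Arguments.
Unset Strict Implicit.
Unset Printing Implicit Defensive.

Local Open Scope classical_set_scope.
Local Open Scope nat_scope.

Definition eta (N : nat) : nat := 2 ^ N - 1.

(* Indices start at 0: the set written e_n in the mathematics is [e (n - 1)]
   here, so the singletons are the values of [e] at the indices below [N]. *)
Definition enumerates_subsets (N : nat) (e : 'I_(eta N) -> {set 'I_N}) : Prop :=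
  [/\ injective e,
      forall A : {set 'I_N}, A != finset.set0 <-> exists n, e n = A
    & forall n : 'I_(eta N), n < N <-> exists i : 'I_N, e n = [set i]%SET].

(* Total function: [fset_set] sends infinite sets to the empty one. Only finite
   sets are counted below, see [finite_DN], [finite_Chat_set] and
   [finite_Ccheck_set]. *)
Definition cardinal (T : choiceType) (A : set T) : nat := #|` fset_set A|.

(* A family indexed by the nonempty subsets, [l n] standing for l_{e_n}. *)
Definition subset_family (N : nat) := {ffun 'I_(eta N) -> nat}.

Definition weight (N : nat) (l : subset_family N) : nat := \sum_(n < eta N) l n.

Definition DN (N : nat) (e : 'I_(eta N) -> {set 'I_N}) (m : {ffun 'I_N -> nat}) :
    set (subset_family N * subset_family N) :=
  [set p : subset_family N * subset_family N | forall j : 'I_N,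
     \sum_(n < eta N) (p.1 n + p.2 n) * (j \in e n) = m j].

Definition Chat_set (N : nat) (e : 'I_(eta N) -> {set 'I_N})
    (m : {ffun 'I_N -> nat}) : set {ffun {n : 'I_(eta N) | N <= n} -> nat} :=
  [set lo : {ffun {n : 'I_(eta N) | N <= n} -> nat} | forall i : 'I_N,
     \sum_(n : {n : 'I_(eta N) | N <= n} | i \in e (val n)) lo n = m i].

Definition Chat (N : nat) (e : 'I_(eta N) -> {set 'I_N})
  (m : {ffun 'I_N -> nat}) : nat := cardinal (Chat_set e m).

Definition Ccheck_set (N : nat) (e : 'I_(eta N) -> {set 'I_N}) (k : nat)
    (m : {ffun 'I_N -> nat}) : set (subset_family N) :=
  [set l : subset_family N | weight l = k /\
     forall i : 'I_N, \sum_(n < eta N | i \in e n) l n = m i].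

Definition Ccheck (N : nat) (e : 'I_(eta N) -> {set 'I_N}) (k : nat)
  (m : {ffun 'I_N -> nat}) : nat := cardinal (Ccheck_set e k m).

Definition splittings (N : nat) (m : {ffun 'I_N -> nat}) :
    set ({ffun 'I_N -> nat} * {ffun 'I_N -> nat}) :=
  [set p : {ffun 'I_N -> nat} * {ffun 'I_N -> nat} |
     forall i : 'I_N, p.1 i + p.2 i = m i].

Lemma finite_bounded (I : finType) (M : nat) :
  finite_set [set f : {ffun I -> nat} | forall i, f i <= M].
Proof.
pose g (h : {ffun I -> 'I_M.+1}) := [ffun i => h i : nat].
apply: (@sub_finite_set _ _ (g @` setT)).
  move=> f /= fM; exists [ffun i => inord (f i)] => //.
  by apply/ffunP => i; rewrite !ffunE inordK// ltnS.
exact/finite_image/finite_finset.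
Qed.

Lemma finite_bounded2 (I J : finType) (M : nat)
    (A : set ({ffun I -> nat} * {ffun J -> nat})) :
  (forall p, A p -> (forall i, p.1 i <= M) /\ (forall j, p.2 j <= M)) ->
  finite_set A.
Proof.
move=> AM; apply: sub_finite_set
  (finite_setX (@finite_bounded I M) (@finite_bounded J M)).
by move=> p /AM.
Qed.

Lemma leq_sum_all (I : finType) (f : I -> nat) (i : I) : f i <= \sum_j f j.
Proof. by rewrite (bigD1 i)//= leq_addr. Qed.

Lemma enum_mem (N : nat) (e : 'I_(eta N) -> {set 'I_N}) n :
  enumerates_subsets e -> exists j, j \in e n.
Proof.
by case=> _ e0 _; apply/finset.set0Pn/e0; exists n.
Qed.

Lemma finite_DN (N : nat) (e : 'I_(eta N) -> {set 'I_N}) m :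
  enumerates_subsets e -> finite_set (DN e m).
Proof.
move=> he; apply: (@finite_bounded2 _ _ (\sum_j m j)) => p Dp.
suff H n : p.1 n + p.2 n <= \sum_j m j.
  by split=> n; apply: leq_trans (H n); [exact: leq_addr|exact: leq_addl].
have [j jn] := enum_mem n he; apply: leq_trans (leq_sum_all m j).
by rewrite -(Dp j) (bigD1 n)//= jn muln1 leq_addr.
Qed.

Lemma finite_Chat_set (N : nat) (e : 'I_(eta N) -> {set 'I_N}) m :
  enumerates_subsets e -> finite_set (Chat_set e m).
Proof.
move=> he; apply: sub_finite_set (@finite_bounded _ (\sum_j m j)) => l Cl n.
have [j jn] := enum_mem (val n) he; apply: leq_trans (leq_sum_all m j).
by rewrite -(Cl j) (bigD1 n)//= leq_addr.
Qed.

Lemma finite_Ccheck_set (N : nat) (e : 'I_(eta N) -> {set 'I_N}) k m :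
  finite_set (Ccheck_set e k m).
Proof.
apply: sub_finite_set (@finite_bounded _ k) => l [<- _] n.
exact: leq_sum_all.
Qed.

Lemma finite_splittings (N : nat) (m : {ffun 'I_N -> nat}) :
  finite_set (splittings m).
Proof.
apply: (@finite_bounded2 _ _ (\sum_j m j)) => p pm.
by split=> i; apply: leq_trans (leq_sum_all m i);
  rewrite -(pm i); [exact: leq_addr|exact: leq_addl].
Qed.

Lemma enumeration_exists (N : nat) :
  exists e : 'I_(eta N) -> {set 'I_N}, enumerates_subsets e.
Proof.
pose s1 := [seq [set i]%SET | i <- enum 'I_N].
pose s2 := [seq A : {set 'I_N} <- enum {: {set 'I_N}} | 1 < #|A|].
pose s := s1 ++ s2.
have s1P A : reflect (exists i, A = [set i]%SET) (A \in s1).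
  by apply: (iffP mapP) => [[i _ ->]|[i ->]]; exists i; rewrite ?mem_enum.
have us : uniq s.
  rewrite cat_uniq map_inj_uniq ?enum_uniq//=; last exact: finset.set1_inj.
  rewrite filter_uniq ?enum_uniq// andbT.
  apply/hasPn => A; rewrite mem_filter => /andP[A1 _].
  by apply/s1P => -[i Ai]; rewrite Ai cards1 in A1.
have memS A : (A \in s) = (A != finset.set0).
  rewrite mem_cat mem_filter mem_enum andbT -card_gt0.
  apply/orP/idP => [[/s1P[i ->]|/ltnW//]|]; first by rewrite cards1.
  rewrite leq_eqVlt => /orP[/eqP/esym/eqP/cards1P[i ->]|]; last by right.
  by left; apply/s1P; exists i.
have szs1 : size s1 = N by rewrite size_map size_enum_ord.
have szs : size s = eta N.
  have /card_uniqP <- := us.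
  rewrite (eq_card (B := mem (~: [set finset.set0])%SET)) ?cardsC1; last first.
    by move=> A; rewrite memS !inE.
  by rewrite -cardsT -powersetT card_powerset cardsT card_ord /eta subn1.
exists (fun n => nth finset.set0 s n); split.
- move=> a b /eqP; rewrite nth_uniq ?szs// => /eqP ab; exact: val_inj.
- move=> A; rewrite -memS; split=> [As|[n <-]]; last by rewrite mem_nth ?szs.
  have lt : index A s < eta N by rewrite -szs index_mem.
  by exists (Ordinal lt); rewrite /= nth_index.
- move=> n; split=> [nN|/s1P]; rewrite nth_cat szs1.
    by rewrite nN; apply/s1P; rewrite mem_nth ?szs1.
  case: ltnP => // Nn.
  have : nth finset.set0 s2 (n - N) \in s2.
    apply: mem_nth; rewrite ltn_subLR//.
    have := ltn_ord n; by rewrite -[X in _ < X]szs size_cat szs1.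
  by rewrite mem_filter => /andP[A1 _] /s1P[i Ai]; rewrite Ai cards1 in A1.
Qed.

(* Main.v *)
Require Import Defs.
From mathcomp Require Import all_boot.
From mathcomp Require Import finmap.
From mathcomp Require Import all_classical.

Local Open Scope classical_set_scope.
Local Open Scope nat_scope.

(** A family [l] indexed by the nonempty subsets has a vector of moments, whose
    entry at [j] adds up the [l n] over the subsets containing [j]. Membership
    of [(l, lo)] in [DN e m] says that the moments of [lo] and of [l] add up to
    [m]. Sorting the pairs on the left-hand side by these two vectors therefore
    yields one class for each splitting of [m] ([cardinal_fibers]), and in the
    class of a splitting the conditions on [lo] and on [l] are independent, so
    that its cardinality is a product ([cardinal_setX]).

    The factor of [l] is [Ccheck] by definition. For [lo], being zero on the
    singletons means being zero at the indices below [N], and such a family is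
    the same thing as its restriction to the other indices, with the same
    moments ([sum_restrict]); this gives [Chat]. *)

(** * Counting finite sets *)

Lemma cardinal_bij (T U : choiceType) (A : set T) (B : set U) (f : T -> U) :
  finite_set A -> set_bij A B f -> cardinal A = cardinal B.
Proof.
move=> finA bijf; have AB : (A #= B)%card.
  have -> : B = f @` A.
    by case: bijf => sAB _ sBA; apply/seteqP; split=> // _ [x Ax <-]; exact: sAB.
  by rewrite card_eq_sym; apply/inj_card_eq; case: bijf.
have finB : finite_set B by rewrite -(eq_finite_set AB).
exact/fcard_eq.
Qed.

Lemma cardinal_setX (T U : choiceType) (A : set T) (B : set U) :
  finite_set A -> finite_set B ->
  cardinal (A `*` B) = cardinal A * cardinal B.
Proof.
move=> finA finB; rewrite /cardinal -(size_allpairs pair).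
apply/perm_size/uniq_perm; first exact: fset_uniq.
  by apply: allpairs_uniq; rewrite ?fset_uniq// => -[? ?] [? ?].
move=> [x y]; rewrite in_fset_set; last exact: finite_setX.
apply/idP/allpairsP => [|[[a b] /= [+ + [-> ->]]]].
  rewrite inE => -[/= Ax By]; exists (x, y).
  by split=> //=; rewrite in_fset_set ?inE.
by rewrite !in_fset_set// !inE.
Qed.

(** Both sides count the pairs [(x, f x)], by [x] or by [f x]. *)
Lemma cardinal_fibers (T U : choiceType) (A : set T) (B : set U) (f : T -> U) :
  finite_set A -> finite_set B -> (forall x, A x -> B (f x)) ->
  cardinal A = \big[addn/0]_(u \in B) cardinal (A `&` f @^-1` [set u]).
Proof.
move=> finA finB fAB; rewrite fsbig_finite//=.
have fibE u : cardinal (A `&` f @^-1` [set u]) =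
    \sum_(x <- fset_set A) (f x == u).
  rewrite -(big_mkcond (fun x => f x == u) (fun=> 1)) sum1_count.
  rewrite /cardinal -size_filter; apply/perm_size/uniq_perm.
  - exact: fset_uniq.
  - exact/filter_uniq/fset_uniq.
  - move=> x; rewrite mem_filter !in_fset_set//; last exact: finite_setIl.
    apply/idP/andP => [/set_mem[Ax <-]|[/eqP fxu /set_mem Ax]].
      by split=> //; exact/mem_set.
    by apply/mem_set; split.
rewrite (eq_bigr _ (fun u _ => fibE u)) exchange_big/=.
rewrite /cardinal -sum1_size big_seq [RHS]big_seq; apply: eq_bigr => x.
rewrite in_fset_set// inE => /fAB Bfx.
rewrite (bigD1_seq (f x)) ?fset_uniq//= ?in_fset_set ?inE// eqxx.
by rewrite big1 // => u; rewrite eq_sym => /negPf ->.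
Qed.

(** * Families indexed by the nonempty subsets *)

Section Families.
Variables (N : nat) (e : 'I_(eta N) -> {set 'I_N}).

Definition moments (l : subset_family N) : {ffun 'I_N -> nat} :=
  [ffun j => \sum_(n < eta N | j \in e n) l n].

Definition restrict (l : subset_family N) :
    {ffun {n : 'I_(eta N) | N <= n} -> nat} :=
  [ffun n => l (val n)].

Definition extend (lo : {ffun {n : 'I_(eta N) | N <= n} -> nat}) :
    subset_family N :=
  [ffun n => oapp lo 0 (insub n)].

Definition vanishes_below (l : subset_family N) : Prop :=
  forall n : 'I_(eta N), n < N -> l n = 0.

Lemma extendK lo : restrict (extend lo) = lo.
Proof. by apply/ffunP => n; rewrite !ffunE valK. Qed.

Lemma extend_vanishes lo : vanishes_below (extend lo).
Proof. by move=> n nN; rewrite ffunE insubN// -ltnNge. Qed.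

Lemma restrict_inj l l' : vanishes_below l -> vanishes_below l' ->
  restrict l = restrict l' -> l = l'.
Proof.
move=> l0 l'0 /ffunP ll'; apply/ffunP => n.
case: (ltnP n N) => [nN|Nn]; first by rewrite l0 ?l'0.
by have := ll' (exist _ n Nn); rewrite !ffunE.
Qed.

Lemma sum_restrict l i : vanishes_below l ->
  \sum_(n : {n : 'I_(eta N) | N <= n} | i \in e (val n)) restrict l n =
  moments l i.
Proof.
move=> l0; rewrite ffunE; under eq_bigr do rewrite ffunE.
rewrite -(big_sub_cond (fun n : 'I_(eta N) => N <= n) (fun n => i \in e n)).
rewrite [RHS](bigID (fun n : 'I_(eta N) => N <= n))/=.
rewrite [X in _ = _ + X]big1 ?addn0.
  by apply: eq_bigl => n; rewrite andbC.
by move=> n /andP[_]; rewrite -ltnNge => /l0.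
Qed.

Lemma DN_moments m p :
  DN e m p <-> forall j, moments p.2 j + moments p.1 j = m j.
Proof.
suff E j : \sum_(n < eta N) (p.1 n + p.2 n) * (j \in e n) =
    moments p.2 j + moments p.1 j by split=> H j; rewrite -(H j) E.
rewrite !ffunE addnC -big_split/= [RHS]big_mkcond/=.
by apply: eq_bigr => n _; case: (j \in e n); rewrite ?muln1 ?muln0.
Qed.

Lemma vanishes_belowP (l : subset_family N) : enumerates_subsets e ->
  (forall (n : 'I_(eta N)) (i : 'I_N), e n = [set i]%SET -> l n = 0) <->
  vanishes_below l.
Proof.
case=> _ _ he; split=> [H n /he[i]|H n i eni]; first exact: H.
by apply: H; apply/he; exists i.
Qed.

(** With [q] in place of [m], no condition links [p.1] to [p.2] any more: the
    pairs form a product, through [restrict] on the second component. *)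
Lemma cardinal_moments_fiber k q : enumerates_subsets e ->
  cardinal [set p : subset_family N * subset_family N |
    [/\ weight p.1 = k, vanishes_below p.2 &
        (moments p.2, moments p.1) = q]] =
  Chat e q.1 * Ccheck e k q.2.
Proof.
move=> he; rewrite -cardinal_setX; last 2 first.
- exact: finite_Chat_set.
- exact: finite_Ccheck_set.
apply: (@cardinal_bij _ _ _ _ (fun p => (restrict p.2, p.1))).
  apply: sub_finite_set (finite_DN [ffun j => q.1 j + q.2 j] he).
  by move=> p [_ _ <-]; apply/DN_moments => j; rewrite [RHS]ffunE.
split.
- move=> p [pk p0 <-]; split=> /= [i|]; first exact: sum_restrict.
  by split=> // i; rewrite ffunE.
- move=> p p'; rewrite !inE => -[_ p0 _] [_ p'0 _] [r12 e1].
  by rewrite [p]surjective_pairing [p']surjective_pairing e1;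
    congr pair; exact: restrict_inj.
- move=> [lo l] [/= Clo [lk Cl]]; exists (l, extend lo); last by rewrite /= extendK.
  split=> //; first exact: extend_vanishes.
  rewrite [q]surjective_pairing; congr pair; apply/ffunP => i.
    by rewrite /= -sum_restrict ?extendK//; exact: extend_vanishes.
  by rewrite ffunE.
Qed.
End Families.

Theorem corollary6p4 (N : nat) (hN : 1 <= N)
  (e : 'I_(eta N) -> {set 'I_N}) (he : enumerates_subsets e)
  (k : nat) (m : {ffun 'I_N -> nat}) :
  cardinal [set p : subset_family N * subset_family N | DN e m p /\ weight p.1 = k /\
              forall (n : 'I_(eta N)) (i : 'I_N), e n = [set i]%SET -> p.2 n = 0]
  = \big[addn/0]_(p \in splittings m) (Chat e p.1 * Ccheck e k p.2).
Proof.
rewrite (@cardinal_fibers _ _ _ (splittings m)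
  (fun p => (moments N e p.2, moments N e p.1))); first last.
- by move=> p [/DN_moments].
- exact: finite_splittings.
- by apply: sub_finite_set (finite_DN m he) => p [].
apply: eq_fsbigr => q; rewrite inE => qm.
rewrite -cardinal_moments_fiber//; congr cardinal.
apply/seteqP; split=> p /=.
  by move=> [[_ [pk /(vanishes_belowP N e _ he) p0]] pq].
move=> [pk /(vanishes_belowP N e _ he) p0 pq]; split=> //; split=> //.
by apply/DN_moments => j; rewrite -(qm j) -pq.
Qed.
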